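(* Let $\beta=\beta^{(3)}=\{\beta_{ij}\}_{i,j\in\mathbb{Z}_+,\,0\le i+j\le 3}$ be a real doubly indexed finite sequence with $\beta_{00}>0$, with associated matrices $\mathcal{M}(1)$ and $B(2)$. If $\mathcal{M}(1)$ is positive semidefinite, $\operatorname{rank}\mathcal{M}(1)\in\{1,2\}$, and $\operatorname{Ran}B(2)\subseteq\operatorname{Ran}\mathcal{M}(1)$, then $\beta$ admits a unique $\operatorname{rank}\mathcal{M}(1)$-atomic representing measure.
   Context: For a real sequence $\beta^{(3)}=\{\beta_{ij}\}_{0\le i+j\le 3}$ set $$\mathcal{M}(1)=\begin{pmatrix}\beta_{00}&\beta_{10}&\beta_{01}\\ \beta_{10}&\beta_{20}&\beta_{11}\\ \beta_{01}&\beta_{11}&\beta_{02}\end{pmatrix},\qquad B(2)=\begin{pmatrix}\beta_{20}&\beta_{11}&\beta_{02}\\ \beta_{30}&\beta_{21}&\beta_{12}\\ \beta_{21}&\beta_{12}&\beta_{03}\end{pmatrix}.$$ $\operatorname{Ran}$ denotes the range (column space) of a matrix. A representing measure for $\beta^{(3)}$ is a positive Borel measure $\mu$ on $\mathbb{R}^2$ such that $\beta_{ij}=\int x^iy^j\,d\mu$ for all $i,j\in\mathbb{Z}_+$ with $0\le i+j\le 3$. A measure is $r$-atomic if it has the form $\mu=\sum_{k=1}^{r}\rho_k\delta_{(x_k,y_k)}$ with weights $\rho_k>0$ and $r$ distinct points (atoms) $(x_k,y_k)\in\mathbb{R}^2$. ''Unique'' means that there is exactly one representing measure that is $\operatorname{rank}\mathcal{M}(1)$-atomic.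 *)

(* Defs.v *)
From HB Require Import structures.
From mathcomp Require Import all_boot all_order all_algebra.
From mathcomp Require Import all_classical all_reals all_analysis.

Set Implicit Arguments.
Unset Strict Implicit.
Unset Printing Implicit Defensive.

Import Order.TTheory GRing.Theory Num.Theory.
Import numFieldNormedType.Exports.

Local Open Scope classical_set_scope.
Local Open Scope ring_scope.

(* A sequence {beta_ij : 0 <= i + j <= 3} is represented by a total function
   nat -> nat -> R; nothing below reads its values at i + j > 3. *)

Definition mx_of_rows (R : realType) (m n : nat) (s : seq (seq R)) :
    'M[R]_(m, n) :=
  \matrix_(i < m, j < n) nth 0 (nth [::] s i) j.

(* Rows and columns indexed by the monomials 1, x, y. *)
Definition moment_mx1 (R : realType) (beta : nat -> nat -> R) : 'M[R]_3 :=
  mx_of_rows 3 3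
    [:: [:: beta 0%N 0%N; beta 1%N 0%N; beta 0%N 1%N];
        [:: beta 1%N 0%N; beta 2%N 0%N; beta 1%N 1%N];
        [:: beta 0%N 1%N; beta 1%N 1%N; beta 0%N 2%N]].

(* Rows indexed by 1, x, y; columns indexed by x^2, xy, y^2. *)
Definition moment_B2 (R : realType) (beta : nat -> nat -> R) : 'M[R]_3 :=
  mx_of_rows 3 3
    [:: [:: beta 2%N 0%N; beta 1%N 1%N; beta 0%N 2%N];
        [:: beta 3%N 0%N; beta 2%N 1%N; beta 1%N 2%N];
        [:: beta 2%N 1%N; beta 1%N 2%N; beta 0%N 3%N]].

Definition psdmx (R : realType) (n : nat) (A : 'M[R]_n) : Prop :=
  A^T = A /\ forall v : 'cV[R]_n, 0 <= (v^T *m A *m v) 0 0.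

(* Ran A is contained in Ran B. The order of %MS compares row spaces, hence the
   transposes. *)
Definition ran_sub (R : realType) (m n p : nat)
    (A : 'M[R]_(m, n)) (B : 'M[R]_(m, p)) : Prop :=
  (A^T <= B^T)%MS.

(* The product sigma-algebra of two copies of the Borel sigma-algebra of R is
   the Borel sigma-algebra of the plane. *)
Definition plane (R : realType) :=
  (measurableTypeR R * measurableTypeR R)%type.

Definition representing_measure (R : realType) (beta : nat -> nat -> R)
    (mu : {measure set (plane R) -> \bar R}) : Prop :=
  forall i j : nat, (i + j <= 3)%N ->
    mu.-integrable setT (fun z : plane R => (z.1 ^+ i * z.2 ^+ j)%:E) /\
    (\int[mu]_(z in setT) (z.1 ^+ i * z.2 ^+ j)%:E = (beta i j)%:E)%E.

(* Measures are total functions on sets, unspecified on non-measurable sets, so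
   they are compared on measurable sets only. *)
Definition same_measure (R : realType)
    (mu nu : {measure set (plane R) -> \bar R}) : Prop :=
  forall A : set (plane R), measurable A -> mu A = nu A.

Definition atomic (R : realType) (r : nat)
    (mu : {measure set (plane R) -> \bar R}) : Prop :=
  exists (rho : 'I_r -> R) (z : 'I_r -> plane R),
    [/\ forall k, 0 < rho k,
        injective z &
        forall A : set (plane R), measurable A ->
          mu A = (\sum_(k < r) (rho k)%:E * \d_(z k) A)%E].

(* Main.v *)
(* A kernel vector [c] of [M(1)] annihilates [B(2)] by the range inclusion, so
   the relation [c0 + c1 x + c2 y = 0] propagates to all moments of degree at
   most 3. In rank 1 there are two such relations and the only possible measure
   is a point mass at the mean. In rank 2 there is one; it reduces the problem
   to a line, where moments of degree at most 3 with positive definite Hankel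
   matrix have a two-atomic Gauss quadrature. For uniqueness, two measures are
   compared on a cubic that vanishes at every atom of both of them but one. *)
Require Import Defs.
From HB Require Import structures.
From mathcomp Require Import all_boot all_order all_algebra.
From mathcomp Require Import all_classical all_reals all_analysis.
From mathcomp Require Import measurable_realfun ring lra.

Import Order.TTheory GRing.Theory Num.Theory.

Set Implicit Arguments.
Unset Strict Implicit.
Unset Printing Implicit Defensive.

Local Open Scope ring_scope.

(** * Finitely atomic measures and integration against them *)

Section AtomicMeasure.
Context {d : measure_display} {T : measurableType d} {R : realType}.
Variables (r : nat) (rho : 'I_r -> R) (z : 'I_r -> T).
Hypothesis rho_gt0 : forall k, 0 < rho k.

(* [msum] takes a sequence of measures indexed by [nat]; values at [n >= r] are
   irrelevant. The absolute value is only there to make the weights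
   nonnegative. *)
Definition atomic_measure : {measure set T -> \bar R} :=
  msum (fun n => mscale (`|oapp rho 0 (insub n)|%:nng)
                        (dirac (oapp z point (insub n)))) r.

Lemma atomic_measureE (A : set T) :
  (atomic_measure A = \sum_(k < r) (rho k)%:E * \d_(z k) A)%E.
Proof.
rewrite /atomic_measure /= /msum; apply: eq_bigr => k _.
by rewrite /= valK /mscale /= gtr0_norm.
Qed.

Lemma ge0_integral_atomic_measure (f : T -> R) :
  measurable_fun [set: T] f -> (forall x, 0 <= f x) ->
  (\int[atomic_measure]_(x in [set: T]) (f x)%:E
   = (\sum_(k < r) rho k * f (z k))%:E)%E.
Proof.
move=> mf f0; rewrite ge0_integral_measure_sum //; last 2 first.
- by move=> x _; rewrite lee_fin.
- exact/measurable_EFinP.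
rewrite -sumEFin; apply: eq_bigr => k _.
rewrite ge0_integral_mscale //; last 2 first.
- exact/measurable_EFinP.
- by move=> x _; rewrite lee_fin.
rewrite integral_dirac //; last exact/measurable_EFinP.
by rewrite /= valK /= gtr0_norm // diracT mul1e EFinM.
Qed.

Lemma integrable_atomic_measure (f : T -> R) :
  measurable_fun [set: T] f ->
  atomic_measure.-integrable [set: T] (fun x => (f x)%:E).
Proof.
move=> mf; apply/integrableP; split; first exact/measurable_EFinP.
rewrite (ge0_integral_atomic_measure (f := fun x => `|f x|)) ?ltry //.
exact: measurableT_comp.
Qed.

Lemma integral_atomic_measure (f : T -> R) :
  measurable_fun [set: T] f ->
  (\int[atomic_measure]_(x in [set: T]) (f x)%:E
   = (\sum_(k < r) rho k * f (z k))%:E)%E.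
Proof.
move=> mf.
rewrite integralE.
under eq_integral do rewrite funeposE -EFin_max.
under [X in (_ - X)%E]eq_integral do rewrite funenegE -EFinN -EFin_max.
rewrite (ge0_integral_atomic_measure (f := fun x => Num.max (f x) 0));
  last 2 first.
- exact: measurable_maxr.
- by move=> x; rewrite le_max lexx orbT.
rewrite (ge0_integral_atomic_measure (f := fun x => Num.max (- f x) 0));
  last 2 first.
- by apply: measurable_maxr => //; exact: measurableT_comp.
- by move=> x; rewrite le_max lexx orbT.
rewrite -EFinB -sumrB; congr EFin; apply: eq_bigr => k _; rewrite -mulrBr.
congr (_ * _).
by case: (leP (f (z k)) 0); case: (leP (- f (z k)) 0); lra.
Qed.

(** Integrals depend only on the values of a measure on measurable sets, and there [mu] agrees with
    [atomic_measure]. *)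
Lemma integral_atomic (mu : {measure set T -> \bar R}) (f : T -> R) :
  (forall A : set T, measurable A ->
     (mu A = \sum_(k < r) (rho k)%:E * \d_(z k) A)%E) ->
  measurable_fun [set: T] f ->
  (\int[mu]_(x in [set: T]) (f x)%:E
   = (\sum_(k < r) rho k * f (z k))%:E)%E.
Proof.
move=> muE mf; rewrite -integral_atomic_measure //.
apply: eq_measure_integral => A mA _.
by rewrite muE // -atomic_measureE.
Qed.

End AtomicMeasure.

Lemma measurable_monomial (R : realType) (i j : nat) :
  measurable_fun [set: plane R] (fun z : plane R => (z.1 ^+ i * z.2 ^+ j : R)).
Proof.
apply: measurable_funM; apply: measurable_funX.
- exact: measurable_fst.
- exact: measurable_snd.
Qed.

(** * Two-atomic quadrature for univariate moments *)

(* The atoms are the roots of the degree-two orthogonal polynomial; after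
   centering at the mean it reads [u^2 - g u - s] with [s > 0] the variance, so
   that its roots have opposite signs. *)
Lemma two_atomic_moments3 (R : rcfType) (m0 m1 m2 m3 : R) :
  0 < m0 -> 0 < m0 * m2 - m1 ^+ 2 ->
  exists rho1 rho2 t1 t2 : R,
    [/\ 0 < rho1, 0 < rho2 & t1 != t2] /\
    [/\ m0 = rho1 + rho2, m1 = rho1 * t1 + rho2 * t2,
        m2 = rho1 * t1 ^+ 2 + rho2 * t2 ^+ 2 &
        m3 = rho1 * t1 ^+ 3 + rho2 * t2 ^+ 3].
Proof.
move=> m0_gt0 d_gt0; have m0_neq0 : m0 != 0 by rewrite gt_eqF.
pose e := m1 / m0; pose s := m2 / m0 - e ^+ 2.
have m1E : m1 = m0 * e by rewrite /e; field.
have m2E : m2 = m0 * (s + e ^+ 2) by rewrite /s; field.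
have s_gt0 : 0 < s.
  have -> : s = (m0 * m2 - m1 ^+ 2) / m0 ^+ 2 by rewrite /s /e; field.
  by rewrite divr_gt0 // exprn_gt0.
have s_neq0 : s != 0 by rewrite gt_eqF.
(* Orthogonality of [u^2 - g u - s] to [u] forces [g] to be the third central moment of the
   normalised data divided by [s]. *)
pose g := (m3 / m0 - 3 * e * s - e ^+ 3) / s.
have m3E : m3 = m0 * (g * s + 3 * e * s + e ^+ 3).
  by rewrite /g; field; rewrite s_neq0.
clearbody e s g; subst m1 m2 m3.
pose D := g ^+ 2 + 4 * s; pose q := Num.sqrt D.
have D_gt0 : 0 < D by rewrite ltr_wpDl ?sqr_ge0 // mulr_gt0.
have qE : q ^+ 2 = g ^+ 2 + 4 * s by rewrite sqr_sqrtr // ltW.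
have q_gt0 : 0 < q by rewrite sqrtr_gt0.
have q_neq0 : q != 0 by rewrite gt_eqF.
have gLq : `|g| < q.
  by rewrite -sqrtr_sqr ltr_sqrt // ltrDl mulr_gt0.
move: gLq; rewrite ltr_norml => /andP[q_gtNg q_gtg].
clearbody q.
(* With centred atoms [u1 = (g + q) / 2] and [u2 = (g - q) / 2], total mass [m0] and mean zero force
   the weights [m0 * (- u2) / q] and [m0 * u1 / q]. *)
exists (m0 * ((q - g) / 2) / q), (m0 * ((q + g) / 2) / q).
exists (e + (g + q) / 2), (e + (g - q) / 2).
have sE : s = (q ^+ 2 - g ^+ 2) / 4 by rewrite qE; field.
split; split.
- by rewrite divr_gt0 // mulr_gt0 //; lra.
- by rewrite divr_gt0 // mulr_gt0 //; lra.
- by apply/eqP; lra.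
- by field.
- by field.
- by rewrite sE; field.
- by rewrite sE; field.
Qed.

(** * Uniqueness of atoms and weights from two-atomic moments *)

Definition two_atomic_moment (R : pzSemiRingType) (rho1 rho2 : R)
    (z1 z2 : R * R) (i j : nat) : R :=
  rho1 * (z1.1 ^+ i * z1.2 ^+ j) + rho2 * (z2.1 ^+ i * z2.2 ^+ j).

(* The cubic [<z - z1', z1 - z1'> <z - z2', z1 - z2'> <z - z2, z1 - z2>]
   vanishes at [z1'], [z2'] and [z2], so equality of its integrals kills its
   value at [z1], a product of squared distances. *)
Lemma two_atomic_mem (R : realFieldType) (rho1 rho2 rho1' rho2' : R)
    (z1 z2 z1' z2' : R * R) :
  0 < rho1 -> z1 != z2 ->
  (forall i j, (i + j <= 3)%N ->
     two_atomic_moment rho1 rho2 z1 z2 i j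
     = two_atomic_moment rho1' rho2' z1' z2' i j) ->
  z1 = z1' \/ z1 = z2'.
Proof.
move: z1 z2 z1' z2' => [x1 y1] [x2 y2] [x1' y1'] [x2' y2'].
move=> rho1_gt0 z1Dz2 mE; rewrite /two_atomic_moment /= in mE.
pose a := x1 - x1'; pose b := y1 - y1'; pose c := x1 - x2'; pose d := y1 - y2'.
pose e := x1 - x2; pose f := y1 - y2.
have E : rho1 * ((a ^+ 2 + b ^+ 2) * (c ^+ 2 + d ^+ 2) * (e ^+ 2 + f ^+ 2)) = 0.
  (* Coefficients of the cubic, whose linear factors are [p + a x + b y],
     [r + c x + d y] and [t + e x + f y]. *)
  pose p := - (a * x1' + b * y1').
  pose r := - (c * x2' + d * y2').
  pose t := - (e * x2 + f * y2).
  pose k00 := p * r * t.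
  pose k10 := a * r * t + p * c * t + p * r * e.
  pose k01 := b * r * t + p * d * t + p * r * f.
  pose k20 := a * c * t + a * r * e + p * c * e.
  pose k02 := b * d * t + b * r * f + p * d * f.
  pose k11 := a * d * t + b * c * t + a * r * f + b * r * e
    + p * c * f + p * d * e.
  pose k30 := a * c * e.
  pose k21 := a * c * f + a * d * e + b * c * e.
  pose k12 := a * d * f + b * c * f + b * d * e.
  pose k03 := b * d * f.
  pose L (w : nat -> nat -> R) := k00 * w 0 0 + k10 * w 1 0 + k01 * w 0 1
    + k20 * w 2 0 + k11 * w 1 1 + k02 * w 0 2
    + k30 * w 3 0 + k21 * w 2 1 + k12 * w 1 2 + k03 * w 0 3.
  pose w i j := rho1 * (x1 ^+ i * y1 ^+ j) + rho2 * (x2 ^+ i * y2 ^+ j).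
  pose w' i j := rho1' * (x1' ^+ i * y1' ^+ j) + rho2' * (x2' ^+ i * y2' ^+ j).
  have LE : L w = L w' by rewrite /L /w !mE.
  transitivity (L w).
    rewrite /L /w /k00 /k10 /k01 /k20 /k11 /k02 /k30 /k21 /k12 /k03 /p /r /t.
    rewrite /a /b /c /d /e /f; ring.
  rewrite LE /L /w' /k00 /k10 /k01 /k20 /k11 /k02 /k30 /k21 /k12 /k03 /p /r /t.
  ring.
have sq0 u v : u ^+ 2 + v ^+ 2 = 0 :> R -> u = 0 /\ v = 0.
  by move=> ?; split; nra.
have [] := eqVneq (a ^+ 2 + b ^+ 2) 0 => [/sq0[a0 b0]|ab0].
  by left; congr (_, _); apply/eqP; rewrite -subr_eq0; apply/eqP.
have [] := eqVneq (c ^+ 2 + d ^+ 2) 0 => [/sq0[c0 d0]|cd0].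
  by right; congr (_, _); apply/eqP; rewrite -subr_eq0; apply/eqP.
move/eqP: E; rewrite !mulf_eq0 (gt_eqF rho1_gt0) (negPf ab0) (negPf cd0) /=.
move=> /eqP/sq0[e0 f0]; case/eqP: z1Dz2.
by congr (_, _); apply/eqP; rewrite -subr_eq0; apply/eqP.
Qed.

(** Subtracting [z2] times the mass identity from the first moments leaves
    [(rho1 - rho1') * (z1 - z2) = 0] in each coordinate. *)
Lemma two_atomic_inj (R : realFieldType) (rho1 rho2 rho1' rho2' : R)
    (z1 z2 : R * R) :
  z1 != z2 ->
  (forall i j, (i + j <= 1)%N ->
     two_atomic_moment rho1 rho2 z1 z2 i j
     = two_atomic_moment rho1' rho2' z1 z2 i j) ->
  rho1 = rho1' /\ rho2 = rho2'.
Proof.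
case: z1 z2 => [x1 y1] [x2 y2] z1Dz2 mE; rewrite /two_atomic_moment /= in mE.
have m00 := mE 0 0 isT; have m10 := mE 1 0 isT; have m01 := mE 0 1 isT.
rewrite !(expr0, expr1, mulr1, mul1r) in m00 m10 m01.
have diff0 u v : rho1 * u + rho2 * v = rho1' * u + rho2' * v ->
    (rho1 - rho1') * (u - v) = 0.
  move=> uvE; transitivity (rho1 * u + rho2 * v - (rho1' * u + rho2' * v)
    - v * (rho1 + rho2 - (rho1' + rho2'))); first by ring.
  by rewrite uvE m00; ring.
suff E : rho1 = rho1' by split=> //; lra.
apply/eqP; rewrite -subr_eq0; apply: contraT => n0; case/eqP: z1Dz2.
move/diff0/eqP: m10; move/diff0/eqP: m01.
rewrite !mulf_eq0 (negPf n0) /= !subr_eq0.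
by move=> /eqP -> /eqP ->.
Qed.

(** [two_atomic_mem], applied to each atom in turn, places [z1] and [z2] among [z1'], [z2']. Being
    distinct, they match them up to a swap, and [two_atomic_inj] compares the weights. *)
Lemma two_atomic_unique (R : realFieldType) (rho1 rho2 rho1' rho2' : R)
    (z1 z2 z1' z2' : R * R) :
  0 < rho1 -> 0 < rho2 -> z1 != z2 ->
  (forall i j, (i + j <= 3)%N ->
     two_atomic_moment rho1 rho2 z1 z2 i j
     = two_atomic_moment rho1' rho2' z1' z2' i j) ->
  [/\ z1 = z1', z2 = z2', rho1 = rho1' & rho2 = rho2'] \/
  [/\ z1 = z2', z2 = z1', rho1 = rho2' & rho2 = rho1'].
Proof.
move=> rho1_gt0 rho2_gt0 z1Dz2 mE.
have momentC s1 s2 w1 w2 i j : two_atomic_moment s1 s2 w1 w2 i j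
    = two_atomic_moment s2 s1 w2 w1 i j :> R by exact: addrC.
have z1P := two_atomic_mem rho1_gt0 z1Dz2 mE.
have z2P : z2 = z1' \/ z2 = z2'.
  apply: (@two_atomic_mem _ rho2 rho1 rho1' rho2' z2 z1) => //.
    by rewrite eq_sym.
  by move=> i j ij; rewrite -mE // momentC.
case: z1P z2P => [z1E|z1E] [z2E|z2E]; subst z1 z2; rewrite ?eqxx // in z1Dz2.
- left; have [] // := @two_atomic_inj _ rho1 rho2 rho1' rho2' z1' z2' z1Dz2.
  by move=> i j ij; rewrite mE // (leq_trans ij).
- right; have [] // := @two_atomic_inj _ rho1 rho2 rho2' rho1' z2' z1' z1Dz2.
  by move=> i j ij; rewrite mE ?(leq_trans ij) // momentC.
Qed.

(** * Moment sequences carried by a line *)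

Definition moment_relation (R : pzSemiRingType) (beta : nat -> nat -> R)
    (c0 c1 c2 : R) :=
  forall i j, (i + j <= 2)%N ->
    c0 * beta i j + c1 * beta i.+1 j + c2 * beta i j.+1 = 0.

(** On the line [y] is affine in [x], so zero variance of [x] forces zero covariance and zero
    variance of [y]. *)
Lemma line_minors (R : fieldType) (beta : nat -> nat -> R) (c0 c1 c2 : R) :
  beta 0 0 != 0 -> c2 != 0 -> moment_relation beta c0 c1 c2 ->
  beta 0 0 * beta 2 0 = beta 1 0 ^+ 2 ->
  beta 0 0 * beta 1 1 = beta 1 0 * beta 0 1 /\
  beta 0 0 * beta 0 2 = beta 0 1 ^+ 2.
Proof.
move=> b00 c2_neq0 rel m20.
have r00 := rel 0 0 isT; have r10 := rel 1 0 isT; have r01 := rel 0 1 isT.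
have E11 : beta 0 0 * beta 1 1 = beta 1 0 * beta 0 1.
  apply: (mulfI c2_neq0); apply/eqP; rewrite -subr_eq0; apply/eqP.
  (* The relation is tested against [x] minus its mean, scaled by [beta 0 0]; this expresses [c2]
     times the covariance through [c1] times the variance of [x]. *)
  transitivity (beta 0 0 * (c0 * beta 1 0 + c1 * beta 2 0 + c2 * beta 1 1)
    - beta 1 0 * (c0 * beta 0 0 + c1 * beta 1 0 + c2 * beta 0 1)
    - c1 * (beta 0 0 * beta 2 0 - beta 1 0 ^+ 2)); first by ring.
  by rewrite r00 r10 m20; ring.
split=> //.
apply: (mulfI c2_neq0); apply/eqP; rewrite -subr_eq0; apply/eqP.
transitivity (beta 0 0 * (c0 * beta 0 1 + c1 * beta 1 1 + c2 * beta 0 2)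
  - beta 0 1 * (c0 * beta 0 0 + c1 * beta 1 0 + c2 * beta 0 1)
  - c1 * (beta 0 0 * beta 1 1 - beta 1 0 * beta 0 1)); first by ring.
by rewrite r00 r01 E11; ring.
Qed.

(* The relation puts the measure on the line [c0 + c1 x + c2 y = 0], where the
   moment problem is the univariate one for [beta i 0]. *)
Lemma line_two_atomic (R : rcfType) (beta : nat -> nat -> R) (c0 c1 c2 : R) :
  0 < beta 0 0 -> c2 != 0 -> moment_relation beta c0 c1 c2 ->
  0 < beta 0 0 * beta 2 0 - beta 1 0 ^+ 2 ->
  exists rho1 rho2 (z1 z2 : R * R),
    [/\ 0 < rho1, 0 < rho2, z1 != z2 &
      forall i j, (i + j <= 3)%N ->
        beta i j = two_atomic_moment rho1 rho2 z1 z2 i j].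
Proof.
move=> b00 c2_neq0 rel d_gt0.
have [rho1 [rho2 [t1 [t2 [[rho1_gt0 rho2_gt0 t12] [m0 m1 m2 m3]]]]]] :=
  two_atomic_moments3 (beta 3 0) b00 d_gt0.
pose y t := - (c0 + c1 * t) / c2.
exists rho1, rho2, (t1, y t1), (t2, y t2); split=> //.
  by apply: contra t12 => /eqP [->].
(* Induction on the power of [y], for all [i] at once: the relation trades a factor [y] for [1] and
   [x], and pure powers of [x] are matched by the quadrature. *)
move=> i j; elim: j i => [|j IHj] i.
  rewrite addn0 /two_atomic_moment /= !expr0 !mulr1.
  by case: i => [|[|[|[|]]]] //; rewrite ?expr0 ?expr1 ?mulr1.
rewrite addnS => ij.
have -> : beta i j.+1 = - (c0 * beta i j + c1 * beta i.+1 j) / c2.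
  by move: (rel i j ij) => /eqP; rewrite addr_eq0 => /eqP ->; field.
rewrite !IHj ?addSn ?(ltnW ij) // /two_atomic_moment /= !exprS /y.
by field.
Qed.

(** * From rank and range conditions to atomic moments *)

Section MomentMatrix.
Variables (R : realType) (beta : nat -> nat -> R).

(** The rows of [M(1)] give the relation at [1], [x], [y]. The columns of [B(2)] are combinations of
    those of [M(1)], hence orthogonal to [c], and give it at [x^2], [xy], [y^2]. *)
Lemma ker_moment_relation (c : 'cV[R]_3) :
  (moment_mx1 beta)^T = moment_mx1 beta ->
  ran_sub (moment_B2 beta) (moment_mx1 beta) ->
  moment_mx1 beta *m c = 0 ->
  moment_relation beta (c 0 0) (c 1 0) (c 2 0).
Proof.
move=> Msym /submxP[D BE] Mc.
have Bc : (moment_B2 beta)^T *m c = 0 by rewrite BE Msym -mulmxA Mc mulmx0.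
have entry (A : 'M[R]_3) : A *m c = 0 ->
    forall i, c 0 0 * A i 0 + c 1 0 * A i 1 + c 2 0 * A i 2 = 0.
  move=> Ac i; have := congr1 (fun u : 'cV[R]_3 => u i 0) Ac.
  rewrite !mxE !big_ord_recl big_ord0 addr0 addrA => <-.
  by rewrite ![c _ _ * _]mulrC; congr (_ * c _ _ + _ * c _ _ + _ * c _ _);
    try congr (A _ _); apply: val_inj.
have M0 := entry _ Mc 0; have M1 := entry _ Mc 1; have M2 := entry _ Mc 2.
have B0 := entry _ Bc 0; have B1 := entry _ Bc 1; have B2 := entry _ Bc 2.
rewrite !mxE /= in M0 M1 M2 B0 B1 B2.
by move=> [|[|[|i]]] [|[|[|j]]].
Qed.

Lemma psd_minors :
  psdmx (moment_mx1 beta) -> 0 < beta 0 0 ->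
  0 <= beta 0 0 * beta 2 0 - beta 1 0 ^+ 2 /\
  0 <= beta 0 0 * beta 0 2 - beta 0 1 ^+ 2.
Proof.
move=> [_ psd] b00.
have quad x y z : 0 <= beta 0 0 * x ^+ 2 + beta 2 0 * y ^+ 2 + beta 0 2 * z ^+ 2
    + 2 * (beta 1 0 * x * y + beta 0 1 * x * z + beta 1 1 * y * z).
  have := psd (\col_(i < 3) nth 0 [:: x; y; z] i).
  rewrite !mxE !big_ord_recl big_ord0 !mxE !big_ord_recl !big_ord0 !mxE /=.
  by congr (0 <= _); ring.
(* At the vectors below, the quadratic form equals [beta 0 0] times the corresponding minor. *)
split; rewrite -(pmulr_rge0 _ b00).
- by have := quad (- beta 1 0) (beta 0 0) 0; congr (0 <= _); ring.
- by have := quad (- beta 0 1) 0 (beta 0 0); congr (0 <= _); ring.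
Qed.

(** The identities make the matrix the product of its first column, divided by [beta 0 0], and its
    first row. *)
Lemma rank_moment_mx1_le1 :
  beta 0 0 != 0 ->
  beta 0 0 * beta 2 0 = beta 1 0 ^+ 2 ->
  beta 0 0 * beta 1 1 = beta 1 0 * beta 0 1 ->
  beta 0 0 * beta 0 2 = beta 0 1 ^+ 2 ->
  (\rank (moment_mx1 beta) <= 1)%N.
Proof.
move=> b00 m20 m11 m02.
have -> : moment_mx1 beta =
    (\col_i ((moment_mx1 beta) i 0 / beta 0 0)) *m row 0 (moment_mx1 beta).
  apply/matrixP => i j; rewrite !mxE big_ord1 !mxE; apply: (mulfI b00).
  rewrite [RHS](_ : _ = nth 0 (nth [::] [:: [:: beta 0 0; beta 1 0; beta 0 1];
      [:: beta 1 0; beta 2 0; beta 1 1];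
      [:: beta 0 1; beta 1 1; beta 0 2]] i) (@ord0 2)
     * nth 0 [:: beta 0 0; beta 1 0; beta 0 1] j); last by field.
  case: i j => [[|[|[|]]] //= _] [[|[|[|]]] //= _];
    by rewrite ?m20 ?m11 ?m02 // mulrC.
exact: mulmx_max_rank.
Qed.

(** The first row spans the row space, so any vector it annihilates is in the kernel. Two such
    vectors express that [x] and [y] equal their means. *)
Lemma rank1_moments :
  psdmx (moment_mx1 beta) -> ran_sub (moment_B2 beta) (moment_mx1 beta) ->
  0 < beta 0 0 -> \rank (moment_mx1 beta) = 1%N ->
  exists z : R * R, forall i j, (i + j <= 3)%N ->
    beta i j = beta 0 0 * (z.1 ^+ i * z.2 ^+ j).
Proof.
move=> [Msym _] ranB b00 rkM; have b00_neq0 : beta 0 0 != 0 by rewrite gt_eqF.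
have /submxP[D ME] : (moment_mx1 beta <= row 0 (moment_mx1 beta))%MS.
  rewrite -(geq_leqif (mxrank_leqif_sup (row_sub _ _))) rkM lt0n mxrank_eq0.
  apply/eqP => /rowP/(_ 0); rewrite !mxE /= => /eqP.
  by rewrite (negPf b00_neq0).
have ker (c : 'cV[R]_3) : row 0 (moment_mx1 beta) *m c = 0 ->
    moment_relation beta (c 0 0) (c 1 0) (c 2 0).
  by move=> Mc; apply: ker_moment_relation => //; rewrite ME -mulmxA Mc mulmx0.
have relx : moment_relation beta (- (beta 1 0 / beta 0 0)) 1 0.
  have := ker (\col_i nth 0 [:: - (beta 1 0 / beta 0 0); 1; 0] i).
  rewrite !mxE /=; apply; apply/matrixP => i j.
  by rewrite !mxE !big_ord_recl big_ord0 !mxE /=; field.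
have rely : moment_relation beta (- (beta 0 1 / beta 0 0)) 0 1.
  have := ker (\col_i nth 0 [:: - (beta 0 1 / beta 0 0); 0; 1] i).
  rewrite !mxE /=; apply; apply/matrixP => i j.
  by rewrite !mxE !big_ord_recl big_ord0 !mxE /=; field.
exists (beta 1 0 / beta 0 0, beta 0 1 / beta 0 0) => /= i j.
(* Pure powers of [x] are reduced by [relx]; each factor [y] is then removed by [rely]. *)
elim: j i => [|j IHj] i.
  rewrite addn0; elim: i => [|i IHi] ilt; first by rewrite !expr0 !mulr1.
  have := relx i 0%N; rewrite addn0 => /(_ ilt).
  rewrite IHi 1?ltnW // exprS => h; lra.
rewrite addnS => ij; have := rely i j ij.
by rewrite IHj 1?ltnW // exprS => h; lra.
Qed.

(** A nonzero kernel vector [v] gives a line, which is a graph over one of the axes. Zero variance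
    along that axis would bring the rank down to 1, so [line_two_atomic] applies. *)
Lemma rank2_moments :
  psdmx (moment_mx1 beta) -> ran_sub (moment_B2 beta) (moment_mx1 beta) ->
  0 < beta 0 0 -> \rank (moment_mx1 beta) = 2%N ->
  exists rho1 rho2 (z1 z2 : R * R),
    [/\ 0 < rho1, 0 < rho2, z1 != z2 &
      forall i j, (i + j <= 3)%N ->
        beta i j = two_atomic_moment rho1 rho2 z1 z2 i j].
Proof.
move=> psdM ranB b00 rkM; have b00_neq0 : beta 0 0 != 0 by rewrite gt_eqF.
have [Msym _] := psdM; have [minx miny] := psd_minors psdM b00.
have rkN : ~~ (\rank (moment_mx1 beta) <= 1)%N by rewrite rkM.
have [v /sub_kermxP vM v_neq0] : exists2 v : 'rV_3,
    (v <= kermx (moment_mx1 beta))%MS & v != 0.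
  by apply/rowV0Pn; rewrite -mxrank_eq0 mxrank_ker rkM.
have rel : moment_relation beta (v 0 0) (v 0 1) (v 0 2).
  have := @ker_moment_relation v^T Msym ranB.
  by rewrite !mxE; apply; rewrite -{1}Msym -trmx_mul vM trmx0.
have [v2|v2_neq0] := eqVneq (v 0 2) 0; last first.
  apply: (line_two_atomic b00 v2_neq0 rel); rewrite lt_def minx andbT.
  apply: contra rkN; rewrite subr_eq0 => /eqP m20.
  have [m11 m02] := line_minors b00_neq0 v2_neq0 rel m20.
  exact: rank_moment_mx1_le1.
(* Otherwise the relation at [1] reads [v 0 0 * beta 0 0 = 0], and [v] vanishes. *)
have v1_neq0 : v 0 1 != 0.
  apply: contra v_neq0 => /eqP v1; apply/eqP/rowP => k; rewrite mxE.
  have := rel 0%N 0%N isT; rewrite v1 v2 !mul0r !addr0 => /eqP.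
  rewrite mulf_eq0 (negPf b00_neq0) orbF => /eqP v0.
  by case: k => [[|[|[|]]] // k];
    [rewrite -[RHS]v0|rewrite -[RHS]v1|rewrite -[RHS]v2];
    congr (v _ _); apply: val_inj.
(* The line is vertical here; exchanging the coordinates makes it a graph. *)
pose betaT i j := beta j i.
have relT : moment_relation betaT (v 0 0) (v 0 2) (v 0 1).
  by move=> i j ij; rewrite /betaT addrAC rel // addnC.
have [||rho1 [rho2 [z1 [z2 [rho1_gt0 rho2_gt0 z12 mE]]]]] :=
    line_two_atomic _ v1_neq0 relT => //.
  rewrite lt_def miny andbT.
  apply: contra rkN; rewrite subr_eq0 => /eqP m02.
  have [m11 m20] := line_minors (b00_neq0 : betaT 0 0 != 0) v1_neq0 relT m02.
  by apply: rank_moment_mx1_le1 => //; rewrite mulrC [RHS]mulrC mulrC.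
exists rho1, rho2, (z1.2, z1.1), (z2.2, z2.1); split=> //.
  apply: contra z12; case: z1 z2 {mE} => [x1 y1] [x2 y2] /=.
  by move=> /eqP[-> ->].
move=> i j; rewrite addnC => /mE; rewrite /betaT => ->.
rewrite /two_atomic_moment /=.
by congr (_ * _ + _ * _); exact: mulrC.
Qed.

End MomentMatrix.

(** * Passage between measures and finite moment sums *)

Lemma big_ord2 (T : Type) (idx : T) (op : Monoid.law idx) (F : 'I_2 -> T) :
  \big[op/idx]_(k < 2) F k = op (F 0) (F 1).
Proof.
rewrite !big_ord_recl big_ord0 Monoid.mulm1.
by congr (op (F _) (F _)); exact: val_inj.
Qed.

Definition atomic_moment (R : realType) (r : nat) (rho : 'I_r -> R)
    (z : 'I_r -> plane R) (i j : nat) : R :=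
  \sum_(k < r) rho k * ((z k).1 ^+ i * (z k).2 ^+ j).

Lemma representing_atomic_measure (R : realType) (beta : nat -> nat -> R)
    (r : nat) (rho : 'I_r -> R) (z : 'I_r -> plane R) :
  (forall k, 0 < rho k) ->
  (forall i j, (i + j <= 3)%N -> beta i j = atomic_moment rho z i j) ->
  representing_measure beta (atomic_measure rho z).
Proof.
move=> rho_gt0 betaE i j ij; split.
  exact: (integrable_atomic_measure z rho_gt0 (measurable_monomial i j)).
rewrite (integral_atomic_measure z rho_gt0 (measurable_monomial i j)).
by rewrite betaE.
Qed.

Lemma representing_atomic_moment (R : realType) (beta : nat -> nat -> R)
    (nu : {measure set (plane R) -> \bar R})
    (r : nat) (rho : 'I_r -> R) (z : 'I_r -> plane R) :
  (forall k, 0 < rho k) ->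
  (forall A : set (plane R), measurable A ->
     (nu A = \sum_(k < r) (rho k)%:E * \d_(z k) A)%E) ->
  representing_measure beta nu ->
  forall i j, (i + j <= 3)%N -> beta i j = atomic_moment rho z i j.
Proof.
move=> rho_gt0 nuE nu_rep i j ij; have [_] := nu_rep i j ij.
by rewrite (integral_atomic rho_gt0 nuE (measurable_monomial i j)) => -[<-].
Qed.

(** The mass is the weight, and the first moments divided by it are the coordinates of the atom. *)
Lemma unique_one_atomic (R : realType) (beta : nat -> nat -> R)
    (mu nu : {measure set (plane R) -> \bar R}) :
  representing_measure beta mu -> atomic 1 mu ->
  representing_measure beta nu -> atomic 1 nu -> same_measure nu mu.
Proof.
move=> mu_rep [rho [z [rho_gt0 _ muE]]] nu_rep [rho' [z' [rho'_gt0 _ nuE]]].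
have mE i j : (i + j <= 3)%N -> rho 0 * ((z 0).1 ^+ i * (z 0).2 ^+ j)
    = rho' 0 * ((z' 0).1 ^+ i * (z' 0).2 ^+ j).
  move=> ij; have := representing_atomic_moment rho_gt0 muE mu_rep ij.
  rewrite (representing_atomic_moment rho'_gt0 nuE nu_rep ij).
  by rewrite /atomic_moment !big_ord1.
have rhoE : rho 0 = rho' 0 by have := mE 0 0 isT; rewrite !expr0 !mulr1.
have zE : z 0 = z' 0.
  have rho'_neq0 : rho' 0 != 0 by rewrite gt_eqF.
  have := mE 1 0 isT; have := mE 0 1 isT.
  rewrite rhoE !expr0 !expr1 !mulr1 !mul1r.
  move=> /(mulfI rho'_neq0) y /(mulfI rho'_neq0) x.
  by rewrite [z 0]surjective_pairing [z' 0]surjective_pairing x y.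
by move=> A mA; rewrite muE // nuE // !big_ord1 rhoE zE.
Qed.

Lemma unique_two_atomic (R : realType) (beta : nat -> nat -> R)
    (mu nu : {measure set (plane R) -> \bar R}) :
  representing_measure beta mu -> atomic 2 mu ->
  representing_measure beta nu -> atomic 2 nu -> same_measure nu mu.
Proof.
move=> mu_rep [rho [z [rho_gt0 z_inj muE]]] nu_rep [rho' [z' [rho'_gt0 _ nuE]]].
have mE i j : (i + j <= 3)%N ->
    two_atomic_moment (rho 0) (rho 1) (z 0) (z 1) i j
    = two_atomic_moment (rho' 0) (rho' 1) (z' 0) (z' 1) i j.
  move=> ij; have := representing_atomic_moment rho_gt0 muE mu_rep ij.
  rewrite (representing_atomic_moment rho'_gt0 nuE nu_rep ij).
  by rewrite /atomic_moment !big_ord2.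
have z01 : z 0 != z 1 :> R * R by apply/eqP => /z_inj.
move=> A mA; rewrite muE // nuE //.
rewrite !big_ord2.
(* The two enumerations of the atoms may differ by a swap, which leaves the sum unchanged. *)
have [[-> -> -> ->]//|[-> -> -> ->]] :=
  two_atomic_unique (rho_gt0 0) (rho_gt0 1) z01 mE.
exact: addeC.
Qed.

Theorem theorem3p5 (R : realType) (beta : nat -> nat -> R)
    (beta00_gt0 : 0 < beta 0%N 0%N)
    (M1_psd : psdmx (moment_mx1 beta))
    (M1_rank : \rank (moment_mx1 beta) = 1%N \/ \rank (moment_mx1 beta) = 2%N)
    (B2_ran : ran_sub (moment_B2 beta) (moment_mx1 beta)) :
  exists mu : {measure set (plane R) -> \bar R},
    [/\ representing_measure beta mu,
        atomic (\rank (moment_mx1 beta)) mu &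
        forall nu : {measure set (plane R) -> \bar R},
          representing_measure beta nu ->
          atomic (\rank (moment_mx1 beta)) nu ->
          same_measure nu mu].
Proof.
case: M1_rank => rkM; rewrite rkM.
- have [z betaE] := rank1_moments M1_psd B2_ran beta00_gt0 rkM.
  pose rho (k : 'I_1) := beta 0 0; pose zs (k : 'I_1) : plane R := z.
  have mu_rep : representing_measure beta (atomic_measure rho zs).
    apply: representing_atomic_measure => // i j ij.
    by rewrite /atomic_moment big_ord1 betaE.
  have mu_at : atomic 1 (atomic_measure rho zs).
    exists rho, zs; split=> //; first by move=> k l _; rewrite !ord1.
    by move=> A _; exact: atomic_measureE.
  exists (atomic_measure rho zs); split=> // nu nu_rep nu_at.
  exact: unique_one_atomic mu_rep mu_at nu_rep nu_at.
- have [rho1 [rho2 [z1 [z2 [rho1_gt0 rho2_gt0 z12 betaE]]]]] :=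
    rank2_moments M1_psd B2_ran beta00_gt0 rkM.
  pose rho (k : 'I_2) := if k == 0 then rho1 else rho2.
  pose zs (k : 'I_2) : plane R := if k == 0 then z1 else z2.
  have rho_gt0 k : 0 < rho k by rewrite /rho; case: ifP.
  have mu_rep : representing_measure beta (atomic_measure rho zs).
    apply: representing_atomic_measure => // i j ij.
    by rewrite /atomic_moment big_ord2 betaE.
  have mu_at : atomic 2 (atomic_measure rho zs).
    exists rho, zs; split=> //; last by move=> A _; exact: atomic_measureE.
    move=> [[|[|k]] // ?] [[|[|l]] // ?] /= => [_|/eqP|/esym/eqP|_];
      rewrite ?(negPf z12) //; exact: val_inj.
  exists (atomic_measure rho zs); split=> // nu nu_rep nu_at.
  exact: unique_two_atomic mu_rep mu_at nu_rep nu_at.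
Qed.
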